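(* Let $\kappa$ be an infinite cardinal and $n\in\omega$. If $\square_{\kappa^{+m}}$ holds for every $m<n$, then there exists a special $(n+1,\kappa)$-ladder of cardinality $\kappa^{+n}$.
   Context: $\square_\lambda$ is Jensen's square principle: there is $\langle C_\alpha\mid\alpha<\lambda^+\text{ limit}\rangle$ with $C_\alpha$ club in $\alpha$, $\mathrm{otp}(C_\alpha)\le\lambda$, and $C_\beta=C_\alpha\cap\beta$ whenever $\beta$ is a limit point of $C_\alpha$. For a set $X$, $\overline{X}^{\top}$ is the join-semilattice on $X\sqcup\{\mathbf 1\}$ with $x\vee y=\mathbf 1$ for all distinct $x,y$; $\overline{k}^{\top}$ is this for $X=\{0,\dots,k-1\}$. A join-semilattice is $\overline{k}^{\top}$-free if it has no join-subsemilattice isomorphic to $\overline{k}^{\top}$. An $(m,\kappa)$-semiladder is a nonempty join-semilattice that is $\overline{(m+1)}^{\top}$-free with all principal ideals of cardinality $<\kappa$; an $(m,\kappa)$-ladder is such a structure that is a lattice. Given a join-semilattice $B$ with least element $\mathbf 0_B$, an ordinal $\gamma$, and $\varrho:[\gamma]^2\to B$ (writing $\varrho(\alpha,\beta)$ for $\varrho(\{\alpha,\beta\})$, with $\varrho(\alpha,\alpha)=\mathbf 0_B$), define $\trianglelefteq_\varrho$ on $\gamma\times B$ by $(\alpha,p)\trianglelefteq_\varrho(\beta,q)$ iff $\alpha\le\beta$ and $p\vee\varrho(\alpha,\beta)\le q$. Recursively: a special $(0,\kappa)$-ladder is the trivial lattice $\{\mathbf 0\}$; for positive $n$, an $(n,\kappa)$-ladder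 $S$ is special if $S=(\gamma\times B,\trianglelefteq_\varrho)$ for some ordinal $\gamma$, some special $(n-1,\kappa)$-ladder $B$, and some $\varrho:[\gamma]^2\to B$ with $\varrho(0,\alpha)=\mathbf 0_B$ for all $\alpha<\gamma$. *)

(* Defs.v *)
From HB Require Import structures.
From mathcomp Require Import all_boot all_order.
From mathcomp Require Import boolp classical_sets functions cardinality wochoice.

Set Implicit Arguments.
Unset Strict Implicit.
Unset Printing Implicit Defensive.

Import Order.TTheory.
Local Open Scope order_scope.
Local Open Scope classical_set_scope.
Local Open Scope card_scope.

(* An ordinal is presented by a well-ordered type of that order type: the      *)
(* elements of the type are the smaller ordinals. A cardinal is an initial     *)
(* ordinal.                                                                    *)

Fact woset_display : Order.disp_t. Proof. exact: Order.Disp tt tt. Qed.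

Record wosetType := WosetType {
  woset_sort :> orderType woset_display;
  woset_wo : well_order (<=%O : rel woset_sort) }.

Definition segment (L : wosetType) (a : L) : set L := [set b | b < a].

Definition card_lt T U (A : set T) (B : set U) : bool :=
  (A #<= B) && ~~ (B #<= A).

Definition is_cardinal (L : wosetType) : Prop :=
  forall a : L, card_lt (segment a) [set: L].

Section PowersetWoset.
Variable T : Type.

Definition powT : Type := {classic set T}.
HB.instance Definition _ := Choice.on powT.

Let R : rel powT := sval (well_ordering_principle powT).
Let Rwo : well_order R. Proof. exact: svalP (well_ordering_principle powT). Qed.
Let Rch : wo_chain R predT. Proof. by move=> A _; apply: Rwo. Qed.

Let R_anti : antisymmetric R.
Proof. by move=> x y; apply: (wo_chain_antisymmetric Rch). Qed.

Let R_trans : transitive R.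
Proof.
move=> y x z Rxy Ryz.
have [|m [[+ mlb] _]] := Rwo (A := [pred t | [|| t == x, t == y | t == z]]).
  by exists x; rewrite inE eqxx.
have Lx := mlb x; have Ly := mlb y; have Lz := mlb z.
rewrite !inE in Lx Ly Lz *; rewrite !eqxx ?orbT in Lx Ly Lz.
case/or3P=> /eqP mE; rewrite mE in Lx Ly Lz; first exact: Lz.
- by have -> : x = y by apply: R_anti; rewrite Rxy Lx.
have zy : z = y by apply: R_anti; rewrite Ryz Ly.
by rewrite zy.
Qed.

Let R_total : total R. Proof. by move=> x y; apply: (wo_chainW Rch). Qed.

Let R_refl : reflexive R. Proof. by move=> x; have := R_total x x; case: R. Qed.

HB.instance Definition _ :=
  @Order.Le_isPOrder.Build woset_display powT R R_refl R_anti R_trans.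
HB.instance Definition _ :=
  @Order.POrder_isTotal.Build woset_display powT R_total.

Definition powerset_woset : wosetType := @WosetType powT Rwo.

End PowersetWoset.

(* The successor cardinal of |L|, as the set of all ordinals of cardinality at *)
(* most |L|. These are all found in a well-ordering of the power set of L,     *)
(* whose order type has cardinality greater than |L|.                          *)

Section SuccCard.
Variable L : wosetType.
Local Notation W := (powerset_woset L).

Definition succ_card_sort : Type := {a : W | segment a #<= [set: L]}.

HB.instance Definition _ := SubChoice.on succ_card_sort.
HB.instance Definition _ :=
  [SubChoice_isSubOrder of succ_card_sort by <: with woset_display].

Fact succ_card_wo : well_order (<=%O : rel succ_card_sort).
Proof.
apply: antisymmetric_well_order => [|A [x Ax]]; first exact: le_anti.
have [|w [[/asboolP[z Az zw] wlb] _]] :=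
    woset_wo (w := W) (A := [pred w | `[< exists2 z, z \in A & val z = w >]]).
  by exists (val x); apply/asboolP; exists x.
exists z; split=> // y Ay; rewrite -Order.le_val zw; apply: wlb.
by apply/asboolP; exists y.
Qed.

Definition succ_card : wosetType := WosetType succ_card_wo.

Lemma card_segment_succ (a : succ_card) : segment a #<= [set: L].
Proof.
apply: card_le_trans (valP a); rewrite -(card_le_eql (inj_card_eq (in2W val_inj))).
by apply: subset_card_le => _ [b ba <-].
Qed.

Lemma succ_card_gt : ~~ ([set: succ_card] #<= [set: L]).
Proof.
have WL : ~~ ([set: W] #<= [set: L]).
  apply/negP => /card_leP[f]; pose g (A : set L) : L := val (f (SigSub (mem_setT (A : W)))).
  have g_inj : injective g.
    move=> A B /val_inj fAB.
    by have /(congr1 val) := 'inj_f (mem_set I) (mem_set I) fAB.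
  pose D := [set x | exists A, g A = x /\ ~ A x].
  have [DgD|nDgD] := pselect (D (g D)); last by apply: (nDgD); exists D.
  by have [A [/g_inj ->]] := DgD.
have [all_le|/existsNP[w0 w0P]] := pselect (forall w : W, segment w #<= [set: L]).
  apply: contra WL; apply: card_le_trans.
  rewrite -(card_le_eqr (inj_card_eq (in2W (@val_inj _ _ succ_card)))).
  by apply: subset_card_le => w _; exists (Sub w (all_le w)).
have [|w [[wP wlb] _]] :=
    woset_wo (w := W) (A := [pred w | ~~ (segment w #<= [set: L])]).
  by exists w0; apply/negP.
apply: contra wP; apply: card_le_trans.
rewrite -(card_le_eqr (inj_card_eq (in2W (@val_inj _ _ succ_card)))).
apply: subset_card_le => v vw.
have vP : segment v #<= [set: L].
  apply: contraTT (vw : v < w) => nvP; rewrite -leNgt; exact: wlb.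
by exists (Sub v vP).
Qed.

Lemma is_cardinal_succ : is_cardinal succ_card.
Proof.
move=> a; rewrite /card_lt card_leT /=; apply: contra succ_card_gt => Sa.
exact: card_le_trans Sa (card_segment_succ a).
Qed.

End SuccCard.

Section Square.
Variable L : wosetType.
Implicit Types (a b c : L) (C : set L).

Definition limit_ordinal a : Prop :=
  (exists b, b < a) /\ forall b, b < a -> exists c, b < c < a.

Definition limit_point C a : Prop :=
  (exists b, b < a) /\ forall b, b < a -> exists2 c, C c & b < c < a.

Definition club C a : Prop :=
  [/\ C `<=` segment a,
      forall b, b < a -> exists2 c, C c & b <= c
    & forall b, b < a -> limit_point C b -> C b].

Definition initial_segment C : Prop := forall a b, C b -> a <= b -> C a.

End Square.

(* The order type of C is that of the initial segment I. *)
Definition otp_le (L M : wosetType) (C : set L) : Prop :=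
  exists I : set M, initial_segment I /\
  exists2 f : L -> M, set_bij C I f & {in C &, {mono f : x y / x <= y}}.

Definition square (L : wosetType) : Prop :=
  exists C : succ_card L -> set (succ_card L),
  forall a, limit_ordinal a ->
  [/\ club (C a) a,
      otp_le L (C a)
    & forall b, limit_point (C a) b -> C b = C a `&` segment b].

(* The semilattice X^T; None is the element 1. *)

Fact flat_display : Order.disp_t. Proof. exact: Order.Disp tt tt. Qed.

Section FlatTop.
Variable X : choiceType.

Definition flat_top : Type := option X.
HB.instance Definition _ := Choice.on flat_top.
Implicit Types x y z : flat_top.

Definition flat_le x y : bool := (x == y) || (y == None).
Definition flat_join x y : flat_top := if x == y then x else None.

Fact flat_le_refl : reflexive flat_le.
Proof. by move=> x; rewrite /flat_le eqxx. Qed.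

Fact flat_le_anti : antisymmetric flat_le.
Proof.
by move=> x y /andP[/orP[/eqP->|/eqP->] /orP[/eqP|/eqP]].
Qed.

Fact flat_le_trans : transitive flat_le.
Proof.
by move=> y x z /orP[/eqP->//|/eqP->] /orP[/eqP<-|/eqP->]; rewrite /flat_le eqxx orbT.
Qed.

HB.instance Definition _ := @Order.Le_isPOrder.Build flat_display
  flat_top flat_le flat_le_refl flat_le_anti flat_le_trans.

Fact flat_leUx x y z : (flat_join x y <= z) = (x <= z) && (y <= z).
Proof.
rewrite /flat_join /Order.le /= /flat_le.
have [->|xy] := eqVneq x y; first by rewrite andbb.
case: z => [z|]; last by rewrite !orbT.
by rewrite !orbF; apply/esym/negP => /andP[/eqP xz]; rewrite -xz eq_sym (negPf xy).
Qed.

HB.instance Definition _ := @Order.POrder_isJoinSemilattice.Build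
  flat_display flat_top flat_join flat_leUx.

End FlatTop.

(* A join-semilattice contains a copy of k^T: a subset A closed under joins,   *)
(* together with a join-preserving bijection from k^T onto A.                  *)
Definition flat_free (k : nat) d (S : joinSemilatticeType d) : Prop :=
  ~ exists A : set S,
      (forall x y, A x -> A y -> A (x `|` y)%O) /\
      exists2 f : flat_top 'I_k -> S,
        set_bij [set: flat_top 'I_k] A f &
        forall x y, f (x `|` y)%O = (f x `|` f y)%O.

Definition semiladder (m : nat) (kappa : wosetType) d
    (S : joinSemilatticeType d) : Prop :=
  [/\ exists x : S, True,
      flat_free m.+1 S
    & forall x : S, card_lt [set y | y <= x] [set: kappa]].

Definition ladder (m : nat) (kappa : wosetType) d (S : latticeType d) : Prop :=
  semiladder m kappa S.

Definition tri_le (gamma : wosetType) d (B : joinSemilatticeType d)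
    (rho : gamma -> gamma -> B) (u v : gamma * B) : bool :=
  (u.1 <= v.1) && ((u.2 `|` rho u.1 v.1)%O <= v.2).

(* A function on unordered pairs, extended by 0 on the diagonal, is a symmetric *)
(* function of two arguments vanishing on the diagonal. The equality            *)
(* S = (gamma * B, tri_le) is read as an order isomorphism h.                   *)
Fixpoint special_ladder (kappa : wosetType) (n : nat) :
    forall d, latticeType d -> Prop :=
  match n with
  | 0 => fun d S => exists o : S, forall x, x = o
  | n'.+1 => fun d S =>
      ladder n'.+1 kappa S /\
      exists (gamma : wosetType) (dB : Order.disp_t) (B : bLatticeType dB)
             (rho : gamma -> gamma -> B),
      [/\ special_ladder kappa n' B,
          forall a, rho a a = \bot /\ forall b, rho a b = rho b a,
          forall z a, (forall b, z <= b) -> rho z a = \bot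
        & exists2 h : S -> gamma * B,
            bijective h & forall x y, (x <= y) = tri_le rho (h x) (h y)]
  end.

(* Main.v *)
(* A special ladder on [gamma * B] is a map [rho] satisfying the two triangle  *)
(* inequalities rho(a,c) <= rho(a,b) \/ rho(b,c) and rho(a,b) <= rho(a,c) \/    *)
(* rho(b,c), for which the sets {a <= b | rho(a,b) <= q} have size < kappa and *)
(* are closed: the inequalities give transitivity and joins, closedness gives  *)
(* meets, and flat-freeness climbs one step because, of k+1 elements with the  *)
(* same pairwise joins, at most one is not in the topmost copy of B.           *)
(* Such a [rho] on kappa^{+(n+1)} with values in the ladder B of size          *)
(* kappa^{+n} is obtained by walking along a square sequence C, as Todorcevic  *)
(* does for the case B = kappa:                                                *)
(*   rho(a,b) = e(otp(C_b /\ a)) \/ rho(a, min(C_b \ a))                       *)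
(*              \/ join of e(otp(C_b /\ x)) \/ rho(x,a) for x in F(b,a),        *)
(* where e(nu) = (nu, 0) and F(b,a) is the finite set of the x < a in C_b with *)
(* no limit point of C_b in (x,a]. As e is not monotone, the summands          *)
(* e(otp(C_b /\ x)) replace the monotonicity of the order type used in the     *)
(* scalar case. Coherence enters as rho(a,l) = rho(a,b) for a limit point l of *)
(* C_b above a. Walks are finite descents steered by the fewer than kappa nu   *)
(* with e(nu) <= q, whence the bound on the number of a.                       *)

Require Import Defs.
From HB Require Import structures.
From mathcomp Require Import all_boot all_order.
From mathcomp Require Import boolp classical_sets functions cardinality.

Set Implicit Arguments.
Unset Strict Implicit.
Unset Printing Implicit Defensive.

Import Order.TTheory.
Local Open Scope order_scope.
Local Open Scope classical_set_scope.
Local Open Scope card_scope.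

(** * Cardinal arithmetic *)

Lemma card_le_fun T U (A : set T) (B : set U) (u0 : U) : A #<= B ->
  exists2 f : T -> U, forall x, A x -> B (f x) &
    forall x y, A x -> A y -> f x = f y -> x = y.
Proof.
elim/Ppointed: U => U in B u0 *; first by have := no u0.
move=> /pcard_leP/injfunPex[f fAB fI]; exists f => // x y Ax Ay.
by apply: fI; rewrite inE.
Qed.

Lemma fun_card_le T U (A : set T) (B : set U) (f : T -> U) :
  (forall x, A x -> B (f x)) ->
  (forall x y, A x -> A y -> f x = f y -> x = y) -> A #<= B.
Proof.
move=> fAB fI; have /injfunPex[g] : exists2 f : T -> U, set_fun A B f & set_inj A f.
  by exists f => // x y /set_mem Ax /set_mem Ay; apply: fI.
exact: inj_card_le.
Qed.

Lemma rel_card_le T U (A : set T) (B : set U) (R : T -> U -> Prop) :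
  (forall x, A x -> exists2 y, B y & R x y) ->
  (forall x x' y, A x -> A x' -> R x y -> R x' y -> x = x') -> A #<= B.
Proof.
move=> RAB RI; have [[x0 Ax0]|A0] := pselect (A !=set0); last first.
  suff -> : A = set0 by apply: card_ge0.
  by apply/seteqP; split => // x Ax; apply: A0; exists x.
have [u0 _ _] := RAB _ Ax0.
have /choice[f fP] : forall x, exists y, A x -> B y /\ R x y.
  move=> x; have [Ax|nAx] := pselect (A x); last by exists u0.
  by have [y By Rxy] := RAB _ Ax; exists y.
apply: (@fun_card_le _ _ _ _ f) => [x /fP[]//|x y Ax Ay fxy].
by have [_ Rx] := fP _ Ax; have [_] := fP _ Ay; rewrite -fxy; apply: RI.
Qed.

Lemma card_le_total T U (A : set T) (B : set U) : (A #<= B) || (B #<= A).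
Proof.
pose P (G : set (T * U)) := (forall x y, G (x, y) -> A x /\ B y) /\
  (forall p q, G p -> G q -> (p.1 = q.1) <-> (p.2 = q.2)).
have [|G [[GAB GI] Gmax]] := @Zorn_bigcup _ P.
  move=> F FP tF; split=> [x y [G FG Gxy]|p q [G FG Gp] [H FH Hq]].
    exact: (FP _ FG).1 Gxy.
  have [GH|HG] := tF _ _ FG FH.
    by apply: (FP _ FH).2 => //; apply: GH.
  by apply: (FP _ FG).2 => //; apply: HG.
have [Atot|/existsNP[x /not_implyP[Ax nx]]] :=
    pselect (forall x, A x -> exists y, G (x, y)).
  apply/orP; left; apply: (@rel_card_le _ _ _ _ (fun x y => G (x, y))) => [x Ax|].
    by have [y Gxy] := Atot _ Ax; exists y => //; have [] := GAB _ _ Gxy.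
  by move=> x1 x2 y _ _ Gx Gx'; apply/(GI _ _ Gx Gx').
have [Btot|/existsNP[y /not_implyP[By ny]]] :=
    pselect (forall y, B y -> exists x, G (x, y)).
  apply/orP; right; apply: (@rel_card_le _ _ _ _ (fun y x => G (x, y))) => [y By|].
    by have [z Gzy] := Btot _ By; exists z => //; have [] := GAB _ _ Gzy.
  by move=> y1 y2 z _ _ Gy Gy'; apply/(GI _ _ Gy Gy').
exfalso; apply: (Gmax (G `|` [set (x, y)])).
  split; first by move=> ? ?; left.
  by move=> /(_ (x, y)) GG; apply: nx; exists y; apply: GG; right.
split=> [x' y' [/GAB//|[-> ->]]//|[x1 y1] [x2 y2] [G1|[-> ->]] [G2|[-> ->]]//=].
- exact: GI G1 G2.
- by split=> e; rewrite e in G1; [case: nx; exists y1|case: ny; exists x1].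
- by split=> e; rewrite -e in G2; [case: nx; exists y2|case: ny; exists x2].
Qed.

Lemma card_le_lt_trans T U V (A : set T) (B : set U) (C : set V) :
  A #<= B -> card_lt B C -> card_lt A C.
Proof.
move=> AB /andP[BC CB]; rewrite /card_lt (card_le_trans AB BC) /=.
by apply: contra CB => CA; apply: card_le_trans CA AB.
Qed.

Lemma card_ltNge T U (A : set T) (B : set U) : card_lt A B = ~~ (B #<= A).
Proof.
by rewrite /card_lt; case/orP: (card_le_total A B) => ->; rewrite ?andbT ?andbF.
Qed.

Lemma finite_card_lt T U (A : set T) (B : set U) :
  finite_set A -> infinite_set B -> card_lt A B.
Proof.
by move=> fA iB; rewrite card_ltNge; apply/negP => /card_le_finite/(_ fA).
Qed.

Lemma card_le_setX T T' U U' (A : set T) (A' : set T') (B : set U) (B' : set U') :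
  A #<= B -> A' #<= B' -> A `*` A' #<= B `*` B'.
Proof.
move=> AB AB'; have [[b Bb]|B0] := pselect (B !=set0); last first.
  suff -> : A `*` A' = set0 by apply: card_ge0.
  have A0 : A = set0.
    apply/(@card_le0P _ U); suff <- : B = set0 by [].
    by apply/seteqP; split=> // x Bx; apply: B0; exists x.
  by apply/seteqP; split=> // -[x y] []; rewrite A0.
have [[b' Bb']|B0'] := pselect (B' !=set0); last first.
  suff -> : A `*` A' = set0 by apply: card_ge0.
  have A0 : A' = set0.
    apply/(@card_le0P _ U'); suff <- : B' = set0 by [].
    by apply/seteqP; split=> // x Bx; apply: B0'; exists x.
  by apply/seteqP; split=> // -[x y] [] _; rewrite A0.
have [f fAB fI] := card_le_fun b AB; have [g gAB gI] := card_le_fun b' AB'.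
apply: (@fun_card_le _ _ _ _ (fun p => (f p.1, g p.2))) => [p [/fAB ? /gAB//]|].
by move=> [x y] [x' y'] [/= Ax Ay] [/= Ax' Ay'] [/fI-> // /gI->].
Qed.

(* Hessenberg's theorem: a maximal injection A * A -> A with A contained in D *)
(* exists by Zorn's lemma, and A is then equipotent to D, since otherwise a   *)
(* disjoint copy of A inside D would allow an extension.                      *)
Section Hessenberg.
Variables (T : Type) (D : set T).
Hypothesis Dinf : infinite_set D.

Let dom (G : set ((T * T) * T)) : set T := [set a | exists c, G ((a, a), c)].

Let P (G : set ((T * T) * T)) : Prop :=
  [/\ G = set0 \/ (exists u v, [/\ dom G u, dom G v & u <> v]),
      dom G `<=` D,
      forall a b c, G ((a, b), c) -> [/\ dom G a, dom G b & dom G c],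
      forall a b, dom G a -> dom G b -> exists c, G ((a, b), c)
    & forall p q, G p -> G q -> (p.1 = q.1) <-> (p.2 = q.2)].

Let domS G H : G `<=` H -> dom G `<=` dom H.
Proof. by move=> GH a [c /GH]; exists c. Qed.

Let P_chain (F : set (set ((T * T) * T))) :
  F `<=` P -> total_on F subset -> P (\bigcup_(X in F) X).
Proof.
move=> FP tF; have FS G : F G -> G `<=` \bigcup_(X in F) X by apply: bigcup_sup.
have FD a : dom (\bigcup_(X in F) X) a -> exists2 G, F G & dom G a.
  by move=> [c [G FG Gc]]; exists G => //; exists c.
have F2 G H : F G -> F H -> exists K, [/\ F K, G `<=` K & H `<=` K].
  by move=> FG FH; have [GH|HG] := tF _ _ FG FH; [exists H|exists G]; split.
split.
- case: (pselect ((\bigcup_(X in F) X) !=set0));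
    last by move=> /set0P/negP/negPn/eqP; left.
  move=> [p [G FG Gp]].
  right; have [[G0|[u [v [Gu Gv uv]]]] _ _ _ _] := FP _ FG; first by rewrite G0 in Gp.
  by exists u, v; split=> //; apply: domS (FS _ FG) _ _.
- by move=> a /FD[G FG Ga]; have [_ + _ _ _] := FP _ FG; apply.
- move=> a b c [G FG Gp]; have [_ _ /(_ _ _ _ Gp)[Ga Gb Gc] _ _] := FP _ FG.
  by split; apply: domS (FS _ FG) _ _.
- move=> a b /FD[G FG Ga] /FD[H FH Hb]; have [K [FK GK HK]] := F2 _ _ FG FH.
  have [_ _ _ KD _] := FP _ FK.
  by have [c Kc] := KD _ _ (domS GK Ga) (domS HK Hb); exists c, K.
- move=> p q [G FG Gp] [H FH Hq]; have [K [FK GK HK]] := F2 _ _ FG FH.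
  by have [_ _ _ _ KI] := FP _ FK; apply: KI; [apply: GK|apply: HK].
Qed.

Let P_start : exists2 G, P G & G !=set0.
Proof.
have [x0 _] := infinite_setN0 Dinf.
have /(card_le_fun x0)[h hD hI] := (infiniteP D).1 Dinf.
have {}hI : injective h by move=> i j; apply: hI.
pose G := [set p : (T * T) * T | exists i j : nat,
  p = ((h i, h j), h (pickle (i, j)))].
have Gh i j : G ((h i, h j), h (pickle (i, j))) by exists i, j.
have Gd i : dom G (h i) by exists (h (pickle (i, i))).
exists G; last by exists ((h 0, h 0), h (pickle (0, 0))); apply: Gh.
split.
- by right; exists (h 0), (h 1); split=> // /hI.
- by move=> _ [_ [i [j [-> _ _]]]]; apply: hD.
- by move=> _ _ _ [i [j [-> -> ->]]].
- by move=> _ _ [_ [i [_ [-> _ _]]]] [_ [j [_ [-> _ _]]]]; exists (h (pickle (i, j))).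
- move=> _ _ [i [j ->]] [k [l ->]] /=; split=> [[/hI-> /hI->]//|].
  by move=> /hI/(pcan_inj pickleK)[-> ->].
Qed.

Lemma card_setX_infinite : D `*` D #<= D.
Proof.
have [G [[G0 GD Gdom Gtot GI] Gmax]] := Zorn_bigcup P_chain.
set A := dom G in GD Gdom Gtot.
have {G0} [u [v [Au Av uv]]] : exists u v, [/\ A u, A v & u <> v].
  case: G0 => // G0; have [H PH [p Hp]] := P_start.
  by case: (Gmax H) => //; rewrite G0; split => // /(_ _ Hp).
have /choice[f fP] : forall p, exists c, A p.1 -> A p.2 -> G (p, c).
  move=> [a b]; have [[Aa Ab]|nAp] := pselect (A a /\ A b).
    by have [c Gc] := Gtot _ _ Aa Ab; exists c.
  by exists u => /= Aa Ab; case: nAp.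
have fG a b c : G ((a, b), c) <-> [/\ A a, A b & c = f (a, b)].
  split=> [Gc|[Aa Ab ->]]; last exact: fP (a, b) Aa Ab.
  by have [Aa Ab _] := Gdom _ _ _ Gc; split=> //; apply/(GI _ _ Gc (fP (a, b) Aa Ab)).
have fA a b : A a -> A b -> A (f (a, b)).
  by move=> Aa Ab; have /Gdom[] := fP (a, b) Aa Ab.
have fI a b a' b' : A a -> A b -> A a' -> A b' ->
    f (a, b) = f (a', b') -> a = a' /\ b = b'.
  move=> Aa Ab Aa' Ab' fab.
  by have [_ /(_ fab)[]] := GI _ _ (fP (a, b) Aa Ab) (fP (a', b') Aa' Ab').
have AA : A `*` A #<= A.
  apply: (@fun_card_le _ _ _ _ f) => [[a b] [Aa Ab]|[a b] [a' b'] [Aa Ab] [Aa' Ab']].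
    exact: fA.
  by move=> /fI[]// -> ->.
have /orP[AD|DA] := card_le_total A (D `\` A); last first.
  have [h hA hI] := card_le_fun u DA.
  have DAA : D #<= A `*` A.
    pose g x := if pselect (A x) then (x, u) else (h x, v).
    apply: (@fun_card_le _ _ _ _ g) => [x Dx|x y Dx Dy]; rewrite /g.
      by case: pselect => //= nAx; split=> //; apply: hA.
    case: pselect => [Ax|nAx]; case: pselect => [Ay|nAy] //= [] // => [_ /esym//|].
    exact: hI.
  have := card_le_setX (card_le_trans DAA AA) (card_le_trans DAA AA).
  by move=> /card_le_trans; apply; apply: card_le_trans AA (subset_card_le GD).
exfalso; have [h hD hI] := card_le_fun u AD.
pose e (s : bool) a := if s then h a else a.
pose w (s : bool) := if s then u else v.
pose k s t a b := f (f (f (a, b), w s), w t).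
pose g s t a b := if s || t then h (k s t a b) else f (a, b).
have Aw s : A (w s) by case: s.
have wI : injective w by case=> [] [] // /esym.
have Ak s t a b : A a -> A b -> A (k s t a b).
  by move=> Aa Ab; rewrite /k; do 3![apply: (fA) => //].
have eI s t a b : A a -> A b -> e s a = e t b -> s = t /\ a = b.
  case: s t => [] [] //= Aa Ab.
  - by move=> /hI->.
  - by move=> hab; have [_] := hD _ Aa; rewrite hab.
  - by move=> hab; have [_] := hD _ Ab; rewrite -hab.
have gE s t a b : A a -> A b -> exists r c, A c /\ g s t a b = e r c.
  move=> Aa Ab; rewrite /g; case: ifP => _; first by exists true, (k s t a b); auto.
  by exists false, (f (a, b)); auto.
have gI s t a b s' t' a' b' : A a -> A b -> A a' -> A b' ->
    g s t a b = g s' t' a' b' -> [/\ s = s', t = t', a = a' & b = b'].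
  move=> Aa Ab Aa' Ab'; rewrite /g; case: ifP => st; case: ifP => st'.
  - move=> /(hI _ _ (Ak s t _ _ Aa Ab) (Ak s' t' _ _ Aa' Ab')).
    have [fs fs'] : A (f (f (a, b), w s)) /\ A (f (f (a', b'), w s')).
      by split; do 2![apply: (fA) => //].
    move=> /(fI _ _ _ _ fs (Aw _) fs' (Aw _))[].
    move=> /(fI _ _ _ _ (fA _ _ Aa Ab) (Aw _) (fA _ _ Aa' Ab') (Aw _))[].
    by move=> /fI[]// -> -> /wI-> /wI->.
  - by move=> hf; have [_ []] := hD _ (Ak s t _ _ Aa Ab); rewrite hf; apply: fA.
  - by move=> hf; have [_ []] := hD _ (Ak s' t' _ _ Aa' Ab'); rewrite -hf; apply: fA.
  - move=> /fI[]// -> ->; move: st st'; clear.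
    by case: s t s' t' => [] [] [] [].
pose H := [set p | exists s t a b, [/\ A a, A b & p = ((e s a, e t b), g s t a b)]].
have HE s t a b : A a -> A b -> H ((e s a, e t b), g s t a b).
  by move=> Aa Ab; exists s, t, a, b.
have Hd s a : A a -> dom H (e s a) by exists (g s s a a); apply: HE.
have GH : G `<=` H.
  by move=> [[a b] c] /fG[Aa Ab ->]; apply: (HE false false).
apply: (Gmax H); first split=> // HG.
  have /HG/Gdom[] := HE true true _ _ Au Au.
  by move=> /= Ahu _ _; have [] := hD _ Au.
split.
- by right; exists u, v; split=> //; [apply: (Hd false)|apply: (Hd false)].
- move=> _ [_ [[] [_ [a [_ [Aa _ [-> _ _]]]]]]]; last exact: GD.
  by have [] := hD _ Aa.
- move=> _ _ _ [s [t [a [b [Aa Ab [-> -> ->]]]]]].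
  have [r [c [Ac ->]]] := gE s t _ _ Aa Ab.
  by split; apply: Hd.
- move=> _ _ [_ [s [_ [a [_ [Aa _ [-> _ _]]]]]]] [_ [t [_ [b [_ [Ab _ [-> _ _]]]]]]].
  by exists (g s t a b); apply: HE.
- move=> _ _ [s [t [a [b [Aa Ab ->]]]]] [s' [t' [a' [b' [Aa' Ab' ->]]]]] /=.
  by split=> [[/eI[]// -> -> /eI[]// -> ->]|/gI[]// -> -> -> ->].
Qed.

End Hessenberg.

Lemma card_le_bigcup I T U (J : set I) (F : I -> set T) (D : set U) :
  infinite_set D -> J #<= D -> (forall i, J i -> F i #<= D) ->
  \bigcup_(i in J) F i #<= D.
Proof.
move=> Dinf JD FD; apply: card_le_trans (card_setX_infinite Dinf).
have [u0 _] := infinite_setN0 Dinf.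
have [j jD jI] := card_le_fun u0 JD.
have /choice[h hP] : forall i, exists h : T -> U, J i ->
    (forall x, F i x -> D (h x)) /\
    (forall x y, F i x -> F i y -> h x = h y -> x = y).
  move=> i; have [Ji|nJ] := pselect (J i); last by exists (fun=> u0).
  by have [h hD hI] := card_le_fun u0 (FD _ Ji); exists h.
apply: (@rel_card_le _ _ _ _
  (fun x p => exists i, [/\ J i, F i x & p = (j i, h i x)])) => [x [i Ji Fx]|].
  exists (j i, h i x); last by exists i.
  by split=> /=; [exact: jD|exact: (hP _ Ji).1].
move=> x x' p _ _ [i [Ji Fx ->]] [i' [Ji' Fx' [/(jI _ _ Ji Ji') e]]].
by rewrite -e in Fx' *; exact: (hP _ Ji).2.
Qed.

Lemma card_lt_setX T T' U (A : set T) (A' : set T') (D : set U) :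
  infinite_set D -> card_lt A D -> card_lt A' D -> card_lt (A `*` A') D.
Proof.
move=> Dinf AD AD'.
have [fA|iA] := pselect (finite_set A); have [fA'|iA'] := pselect (finite_set A').
- by apply: finite_card_lt => //; apply: finite_setX.
- apply: card_le_lt_trans AD'; apply: card_le_trans (card_setX_infinite iA').
  apply: card_le_setX => //; case/orP: (card_le_total A A') => //.
  by move=> /card_le_finite/(_ fA).
- apply: card_le_lt_trans AD; apply: card_le_trans (card_setX_infinite iA).
  apply: card_le_setX => //; case/orP: (card_le_total A A') => //.
  by move=> /card_le_finite/(_ fA').
case/orP: (card_le_total A A') => AA'.
  apply: card_le_lt_trans AD'; apply: card_le_trans (card_setX_infinite iA').
  exact: card_le_setX.
apply: card_le_lt_trans AD; apply: card_le_trans (card_setX_infinite iA).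
exact: card_le_setX.
Qed.

Lemma card_le_setU1 T U (A : set T) (x : T) (D : set U) :
  infinite_set D -> A #<= D -> x |` A #<= D.
Proof.
move=> Dinf AD; pose F (b : bool) := if b then [set x] else A.
have -> : x |` A = \bigcup_(b in [set: bool]) F b.
  apply/seteqP; split=> [y [->|Ay]|y [[] _ /=]]; [by exists true|by exists false|..].
    by left.
  by right.
have fin_le V (S : set V) : finite_set S -> S #<= D.
  by move=> fS; case/orP: (card_le_total S D) => // /card_le_finite/(_ fS).
by apply: card_le_bigcup => // [|[] _ /=]; [apply: fin_le|apply: fin_le|].
Qed.

Lemma card_lt_setU1 T U (A : set T) (x : T) (D : set U) :
  infinite_set D -> card_lt A D -> card_lt (x |` A) D.
Proof.
move=> Dinf AD; have [fA|iA] := pselect (finite_set A).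
  by apply: finite_card_lt => //; rewrite finite_setU.
by apply: card_le_lt_trans AD; apply: card_le_setU1.
Qed.

Section Woset.
Variable L : wosetType.
Implicit Types (a b : L).

Lemma woset_min (A : set L) : A !=set0 -> exists2 m, A m & forall x, A x -> m <= x.
Proof.
move=> [x Ax]; have [|m [[Am mlb] _]] := woset_wo (w := L) (A := mem A).
  by exists x; rewrite inE.
by exists m => [|y Ay]; [rewrite inE in Am|apply: mlb; rewrite inE].
Qed.

Lemma woset_lt_wf : well_founded (fun a b => a < b).
Proof.
move=> a; apply: contrapT => na.
have [|m nm mP] := @woset_min [set a | ~ Acc (fun a b => a < b) a]; first by exists a.
apply: nm; constructor=> b bm; apply: contrapT => /mP.
by rewrite leNgt bm.
Qed.

Lemma woset_ind (P : L -> Prop) :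
  (forall a, (forall b, b < a -> P b) -> P a) -> forall a, P a.
Proof. by move=> PI a; elim: (woset_lt_wf a) => {}a _; apply: PI. Qed.

End Woset.

(** * Walks along a square sequence *)

Record coherent (kappa gamma : wosetType) d (B : bLatticeType d)
    (rho : gamma -> gamma -> B) : Prop := Coherent {
  rho_diag : forall a, rho a a = \bot;
  rho_sym : forall a b, rho a b = rho b a;
  rho_tri : forall a b c q, a <= b -> b <= c -> rho b c <= q ->
    (rho a b <= q) = (rho a c <= q);
  rho_least : forall z a, (forall b, z <= b) -> rho z a = \bot;
  rho_closed : forall a b q,
    limit_point [set x | rho x b <= q] a -> a <= b -> rho a b <= q;
  rho_small : forall b q,
    card_lt [set a | a <= b /\ rho a b <= q] [set: kappa] }.

Section Walk.
Variables (M L kappa : wosetType) (d : Order.disp_t) (B : bLatticeType d).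
Variables (C : M -> set M) (f : M -> M -> L) (e : L -> B).
Implicit Types (a b c x y l : M) (q : B).

(* [f b x] stands for the order type of C_b below x, for x in C_b. *)
Hypothesis C_lt : forall b x, C b x -> x < b.
Hypothesis C_cof : forall b a, a < b -> exists2 x, C b x & a <= x.
Hypothesis C_closed : forall b l, l < b -> limit_point (C b) l -> C b l.
Hypothesis C_coh : forall b l, l < b -> limit_point (C b) l ->
  C l = C b `&` segment l.
Hypothesis f_mono : forall b x y, C b x -> C b y -> x < y -> f b x < f b y.
Hypothesis f_init : forall b x n, C b x -> n < f b x -> exists2 y, C b y & f b y = n.
Hypothesis kappa_inf : infinite_set [set: kappa].
Hypothesis e_least : forall z, (forall n, z <= n) -> e z = \bot.
Hypothesis e_closed : forall n q, limit_point [set m | e m <= q] n -> e n <= q.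
Hypothesis e_small : forall q, card_lt [set n | e n <= q] [set: kappa].

Let f_inj b x y : C b x -> C b y -> f b x = f b y -> x = y.
Proof.
move=> Cx Cy fxy; have [xy|yx|//] := ltgtP x y.
  by have := f_mono Cx Cy xy; rewrite fxy ltxx.
by have := f_mono Cy Cx yx; rewrite fxy ltxx.
Qed.

Let f_coh b l : l < b -> limit_point (C b) l -> forall x, C l x -> f l x = f b x.
Proof.
move=> lb Cl; have Cb x : C l x -> C b x by rewrite (C_coh lb Cl) => -[].
elim/woset_ind => x IH Cx; have [lt|gt|//] := ltgtP (f l x) (f b x).
  have [y Cy fy] := f_init (Cb _ Cx) lt.
  have yx : y < x.
    rewrite ltNge le_eqVlt; apply/negP => /orP[/eqP xy|xy].
      by move: lt; rewrite -fy xy ltxx.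
    by have := lt_trans lt (f_mono (Cb _ Cx) Cy xy); rewrite fy ltxx.
  have Cly : C l y by rewrite (C_coh lb Cl); split=> //; apply: lt_trans yx (C_lt Cx).
  by have := f_mono Cly Cx yx; rewrite IH// fy ltxx.
have [y Cy fy] := f_init Cx gt.
have yx : y < x.
  rewrite ltNge le_eqVlt; apply/negP => /orP[/eqP xy|xy].
    by move: gt; rewrite -fy xy ltxx.
  by have := lt_trans gt (f_mono Cx Cy xy); rewrite fy ltxx.
by have := f_mono (Cb _ Cy) (Cb _ Cx) yx; rewrite -IH// fy ltxx.
Qed.

Let nxt_ex : exists nxt : M -> M -> M, forall b a, a < b ->
  [/\ C b (nxt b a), a <= nxt b a & forall x, C b x -> a <= x -> nxt b a <= x].
Proof.
suff /choice[g gP] : forall p : M * M, exists n, p.2 < p.1 ->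
    [/\ C p.1 n, p.2 <= n & forall x, C p.1 x -> p.2 <= x -> n <= x].
  by exists (fun b a => g (b, a)) => b a; exact: (gP (b, a)).
move=> [b a] /=; have [ab|nab] := pselect (a < b); last by exists a.
have [|n [Cn an] nP] := @woset_min M [set x | C b x /\ a <= x].
  by have [x Cx ax] := C_cof ab; exists x.
by exists n; split=> // x Cx ax; apply: nP.
Qed.

Let F b a : set M := [set x | [/\ C b x, x < a &
  forall l, limit_point (C b) l -> x < l -> a < l]].

Let F_finite b a : a < b -> finite_set (F b a).
Proof.
elim/woset_ind: a => a IH ab.
have [la|nla] := pselect (limit_point (C b) a).
  suff -> : F b a = set0 by [].
  by apply/seteqP; split=> // x [_ xa /(_ _ la xa)]; rewrite ltxx.
have [[y ya]|a0] := pselect (exists y, y < a); last first.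
  suff -> : F b a = set0 by [].
  by apply/seteqP; split=> // x [_ xa]; case: a0; exists x.
have [|m [ma mP] mmin] :=
    @woset_min M [set m | m < a /\ forall x, C b x -> ~ m < x < a].
  apply: contrapT => no; apply: nla; split; first by exists y.
  move=> z za; apply: contrapT => nz; apply: no; exists z; split=> // x Cx xz.
  by apply: nz; exists x.
apply: (@sub_finite_set _ _ (m |` F b m)); last first.
  by rewrite finite_setU; split; [exact: finite_set1|exact: IH (lt_trans ma ab)].
move=> x [Cx xa xl]; have xm : x <= m.
  by rewrite leNgt; apply/negP => mx; apply: (mP _ Cx); rewrite mx.
move: xm; rewrite le_eqVlt => /orP[/eqP->|xm]; [by left|right].
by split=> // l ll xlt; apply: lt_trans ma (xl _ ll xlt).
Qed.

(* [r b a] is rho(a,b) for a <= b; the join is described by its upper bounds. *)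
Let r_ex : exists r : M -> M -> B, [/\ forall a, r a a = \bot &
  forall b a q, a < b -> (r b a <= q) <-> exists n,
    [/\ [/\ C b n, a <= n & forall x, C b x -> a <= x -> n <= x],
        e (f b n) <= q, r n a <= q
      & forall x, F b a x -> e (f b x) <= q /\ r a x <= q]].
Proof.
have [nxt nxtP] := nxt_ex.
have [s sP] : exists s : M -> M -> seq M, forall b a, a < b -> F b a = [set` s b a].
  suff /choice[g gP] : forall p : M * M, exists s : seq M, p.2 < p.1 ->
      F p.1 p.2 = [set` s].
    by exists (fun b a => g (b, a)) => b a; exact: (gP (b, a)).
  move=> [b a] /=; have [ab|nab] := pselect (a < b); last by exists [::].
  by have /finite_seqP[s ->] := F_finite ab; exists s.
pose step b (rec : forall c, c < b -> M -> B) a : B :=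
  let rec' c := if pselect (c < b) is left cb then rec c cb else fun=> \bot in
  if pselect (a < b) is left ab then
    (e (f b (nxt b a)) `|` rec' (nxt b a) a `|`
      \join_(x <- s b a) (e (f b x) `|` rec' a x))%O
  else \bot.
pose r := Fix (@woset_lt_wf M) (fun=> M -> B) step.
have rE b a : r b a = if pselect (a < b) is left ab then
    (e (f b (nxt b a)) `|` r (nxt b a) a `|`
      \join_(x <- s b a) (e (f b x) `|` r a x))%O
  else \bot.
  rewrite /r Fix_eq /=.
    rewrite /step; case: pselect => // ab; have [Cn an nmin] := nxtP _ _ ab.
    by case: pselect => [?|[]]; last exact: C_lt.
  move=> x g g' gg'; apply/funext => y; rewrite /step.
  suff -> : g = g' by [].
  by apply/functional_extensionality_dep => c; apply/functional_extensionality_dep => ?.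
exists r; split=> [a|b a q ab]; first by rewrite rE; case: pselect => //; rewrite ltxx.
rewrite rE; case: pselect => // {}ab; rewrite !leUx -andbA.
have [Cn an nmin] := nxtP _ _ ab; split.
  case/and3P=> eq rq /joinsP_seq jq; exists (nxt b a); split=> // x.
  by rewrite (sP _ _ ab) => /= xs; have := jq _ xs isT; rewrite leUx => /andP.
case=> n [[Cn' an' nmin'] eq rq Fq].
have <- : n = nxt b a by apply/le_anti; rewrite nmin ?nmin'.
rewrite eq rq /=; apply/joinsP_seq => x xs _; rewrite leUx; apply/andP.
by apply: Fq; rewrite (sP _ _ ab).
Qed.

Section Recursion.
Variable r : M -> M -> B.
Hypothesis r_diag : forall a, r a a = \bot.
Hypothesis rP : forall b a q, a < b -> (r b a <= q) <-> exists n,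
  [/\ [/\ C b n, a <= n & forall x, C b x -> a <= x -> n <= x],
      e (f b n) <= q, r n a <= q
    & forall x, F b a x -> e (f b x) <= q /\ r a x <= q].

Let r_limit b l a q : l < b -> limit_point (C b) l -> a < l ->
  (r l a <= q) <-> (r b a <= q).
Proof.
move=> lb Cl al; rewrite (rP _ al) (rP _ (lt_trans al lb)).
have CE x : C l x <-> C b x /\ x < l by rewrite (C_coh lb Cl).
have limE m : m <= l -> limit_point (C l) m <-> limit_point (C b) m.
  move=> ml; split=> -[m0 mP]; split=> // y /mP[x Cx xym]; exists x => //.
    by have [] := (CE x).1 Cx.
  by apply/CE; split=> //; case/andP: xym => _ /lt_le_trans; apply.
have FE x : F l a x <-> F b a x.
  have lim_lt (D : set M) :
      (forall m, m <= l -> limit_point D m <-> limit_point (C b) m) ->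
      (forall m, limit_point D m -> x < m -> a < m) <->
      (forall m, limit_point (C b) m -> x < m -> a < m).
    move=> DE; split=> xl m mm xm; (have [ml|lm] := leP m l; last exact: lt_trans al lm).
      by apply: xl xm; apply/(DE _ ml).
    by apply: xl xm; apply/(DE _ ml).
  split=> -[Cx xa xl]; (split=> //; last exact/(lim_lt _ limE)).
    by have [] := (CE x).1 Cx.
  by apply/CE; split=> //; apply: lt_trans xa al.
split=> -[n [[Cn an nmin] en rn Fn]]; exists n.
- split=> //.
  split=> //; first by have [] := (CE n).1 Cn.
  move=> x Cx ax; have [xl|lx] := ltP x l; first by apply: nmin => //; apply/CE.
  by apply: ltW; apply: lt_le_trans (C_lt Cn) lx.
  by rewrite -(f_coh lb Cl).
  move=> x Fx; have [Cx xa _] := Fx; have Clx : C l x.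
    by apply/CE; split=> //; apply: lt_trans xa al.
  by rewrite -(f_coh lb Cl)//; apply: Fn; apply/FE.
- have nl : n < l.
    have [_ /(_ _ al)[x Cx /andP[ax xl]]] := Cl.
    exact: le_lt_trans (nmin _ Cx (ltW ax)) xl.
  have Cln : C l n by apply/CE.
  split=> // [||x /[dup] -[Clx _ _] /FE Fx].
  - by split=> // x /CE[Cx _]; exact: nmin.
  - by rewrite (f_coh lb Cl).
  - by rewrite (f_coh lb Cl)//; exact: Fn.
Qed.

Let limit_max b a x : a < b ->
  (exists2 l, limit_point (C b) l & x < l <= a) ->
  exists l, [/\ limit_point (C b) l, x < l, l <= a & l = a \/ F b a l].
Proof.
move=> ab [l0 l0l /andP[xl0 l0a]].
have [|m mub mmin] := @woset_min M
    [set m | forall l, limit_point (C b) l -> l <= a -> l <= m]; first by exists a.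
have ma : m <= a by apply: mmin.
have xm : x < m by apply: lt_le_trans xl0 (mub _ l0l l0a).
have ml : limit_point (C b) m.
  split=> [|y ym]; first by exists x.
  apply: contrapT => ny; suff : m <= y by rewrite leNgt ym.
  apply: mmin => l ll la; rewrite leNgt; apply/negP => yl; apply: ny.
  have [_ /(_ _ yl)[z Cz /andP[yz zl]]] := ll.
  by exists z => //; rewrite yz (lt_le_trans zl)// mub.
exists m; split=> //; move: ma; rewrite le_eqVlt => /orP[/eqP->|ma]; [by left|right].
split=> //; first exact: C_closed (lt_trans ma ab) ml.
move=> l ll ml'; rewrite ltNge; apply/negP => la.
by have := mub _ ll la; rewrite leNgt ml'.
Qed.

(* Simultaneous induction on c: the left-to-right and right-to-left parts are *)
(* the two triangle inequalities, and each needs the other below c.          *)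
Let r_tri c : forall a b q, a <= b -> b <= c -> r c b <= q ->
  (r b a <= q) = (r c a <= q).
Proof.
elim/woset_ind: c => c IH a b q; rewrite le_eqVlt => /orP[/eqP->|ab].
  by rewrite r_diag le0x => _ ->.
rewrite le_eqVlt => /orP[/eqP->//|bc] rcb.
have ac := lt_trans ab bc.
have [n [[Cn bn nmin] en rn Fn]] := (rP _ bc).1 rcb.
have [lim|nlim] := pselect (exists2 l, limit_point (C c) l & a < l <= b).
  have [l [ll al lb Fl]] := limit_max bc lim.
  have rbl : r b l <= q.
    by case: Fl => [->|/Fn[]//]; rewrite r_diag le0x.
  rewrite -(IH b bc a l q (ltW al) lb rbl).
  by apply/idP/idP => /(r_limit q (le_lt_trans lb bc) ll al).
have Fab x : C c x -> x < b -> (a <= x \/ F c a x) -> F c b x.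
  move=> Cx xb aFx; split=> // l ll xl; rewrite ltNge; apply/negP => lb.
  apply: nlim; exists l => //; rewrite lb andbT.
  by case: aFx => [ax|[_ _ H]]; [exact: le_lt_trans xl|exact: H].
have r_nb m : C c m -> a <= m -> (forall x, C c x -> a <= x -> m <= x) ->
    e (f c m) <= q /\ (r b a <= q) = (r m a <= q).
  move=> Cm am mmin; have mc := C_lt Cm; have [bm|mb] := leP b m.
    have <- : n = m.
      by apply/le_anti; rewrite nmin//= mmin//; exact: le_trans (ltW ab) bn.
    by split=> //; apply: IH => //; [exact: C_lt|exact: ltW].
  have [em rm] := Fn _ (Fab _ Cm mb (or_introl am)).
  by split=> //; rewrite (IH b bc a m q am (ltW mb) rm).
apply/idP/idP => [rba|/(rP _ ac)[m [[Cm am mmin] em rma _]]]; last first.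
  by have [_ ->] := r_nb _ Cm am mmin.
have [|m [Cm am] mP] := @woset_min M [set x | C c x /\ a <= x].
  by exists n; split=> //; exact: le_trans (ltW ab) bn.
have mmin x : C c x -> a <= x -> m <= x by move=> Cx ax; apply: mP.
have [em mE] := r_nb _ Cm am mmin.
apply/(rP _ ac); exists m; split=> //; first by rewrite -mE.
move=> x Fx; have [Cx xa _] := Fx.
have [ex rx] := Fn _ (Fab _ Cx (lt_trans xa ab) (or_intror Fx)).
by split=> //; rewrite (IH b bc x a q (ltW xa) (ltW ab) rba).
Qed.

Let r_least z : (forall a, z <= a) -> forall b, r b z = \bot.
Proof.
move=> zP; elim/woset_ind => b IH; have := zP b.
rewrite le_eqVlt => /orP[/eqP->|zb]; first exact: r_diag.
apply/eqP; rewrite -lex0; apply/(rP _ zb).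
have [|m Cm mP] := @woset_min M (C b); first by have [x] := C_cof zb; exists x.
exists m; split=> [||| x [_ + _]]; last by rewrite ltNge zP.
- by split=> // x Cx _; apply: mP.
- rewrite e_least// => n; rewrite leNgt; apply/negP => nm.
  have [y Cy fy] := f_init Cm nm; have := mP _ Cy; rewrite le_eqVlt => /orP[/eqP my|my].
    by rewrite -fy my ltxx in nm.
  by have := f_mono Cm Cy my; rewrite fy ltNge (ltW nm).
- by rewrite IH//; exact: C_lt.
Qed.

Let r_closed b : forall a q, limit_point [set x | r b x <= q] a -> a <= b -> r b a <= q.
Proof.
elim/woset_ind: b => b IH a q la; rewrite le_eqVlt => /orP[/eqP->|ab].
  by rewrite r_diag le0x.
have [[y0 y0a] laP] := la.
have [ll|nll] := pselect (limit_point (C b) a).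
  have Ca := C_closed ab ll.
  apply/(rP _ ab); exists a; split=> [||| x [_ xa /(_ _ ll xa)]]; last by rewrite ltxx.
  - by split=> // x.
  - apply: e_closed; split.
      by have [_ /(_ _ y0a)[x Cx /andP[_ xa]]] := ll; exists (f b x); apply: f_mono.
    move=> m ma; have [y Cy fy] := f_init Ca ma.
    have ya : y < a.
      rewrite ltNge le_eqVlt; apply/negP => /orP[/eqP ay|ay].
        by rewrite -fy ay ltxx in ma.
      by have := f_mono Ca Cy ay; rewrite fy ltNge (ltW ma).
    have [x /= rx /andP[yx xa]] := laP _ ya.
    have [n [[Cn xn nmin] en rn Fn]] := (rP q (lt_trans xa ab)).1 rx.
    exists (f b n) => //; rewrite -fy; apply/andP; split.
      by apply: f_mono => //; exact: lt_le_trans xn.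
    have [_ /(_ _ xa)[z Cz /andP[xz za]]] := ll.
    apply: f_mono => //; exact: le_lt_trans (nmin _ Cz (ltW xz)) za.
  - by rewrite r_diag le0x.
have [y ya yC] : exists2 y, y < a & forall x, C b x -> y < x -> a <= x.
  apply: contrapT => no; apply: nll; split; first by exists y0.
  move=> z za; apply: contrapT => nz; apply: no; exists z => // x Cx zx.
  by rewrite leNgt; apply/negP => xa; apply: nz; exists x; rewrite ?zx.
have [x0 /= rx0 /andP[yx0 x0a]] := laP _ ya.
have [n [[Cn xn nmin] en rn Fn]] := (rP q (lt_trans x0a ab)).1 rx0.
have an : a <= n by apply: yC => //; exact: lt_le_trans xn.
have nb := C_lt Cn.
have rna : r n a <= q.
  apply: IH => //; split; first by exists y0.
  move=> z za; have [x /= rx /andP[zyx xa]] : exists2 x, [set x | r b x <= q] x &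
      Order.max z y < x < a by apply: laP; rewrite gt_max za.
  move: zyx; rewrite gt_max => /andP[zx yx]; exists x; last by rewrite zx.
  have [n' [[Cn' xn' nmin'] _ rn' _]] := (rP q (lt_trans xa ab)).1 rx.
  suff <- : n' = n by [].
  apply/le_anti; rewrite nmin'//; last exact: le_trans (ltW xa) an.
  by rewrite nmin//; apply: le_trans (ltW x0a) (yC _ Cn' (lt_le_trans yx xn')).
have rax0 : r a x0 <= q by rewrite (r_tri (ltW x0a) an rna).
apply/(rP _ ab); exists n; split=> // [|x Fx].
  by split=> // x Cx ax; apply: nmin => //; exact: le_trans (ltW x0a) ax.
have [Cx xa xl] := Fx.
have xx0 : x < x0.
  rewrite ltNge; apply/negP => x0x.
  by have := yC _ Cx (lt_le_trans yx0 x0x); rewrite leNgt xa.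
have [ex rx] : e (f b x) <= q /\ r x0 x <= q.
  by apply: Fn; split=> // l ll lx; apply: lt_trans x0a (xl _ ll lx).
by split=> //; rewrite -(r_tri (ltW xx0) (ltW x0a) rax0).
Qed.

Let r_small b q : card_lt [set a | a <= b /\ r b a <= q] [set: kappa].
Proof.
pose J := [set n | e n <= q].
pose X b := [set x | C b x /\ e (f b x) <= q].
have XJ c : X c #<= J.
  apply: (@fun_card_le _ _ _ _ (f c)) => [x []//|x y [Cx _] [Cy _]]; exact: f_inj.
have sub c : [set a | a <= c /\ r c a <= q] `<=`
    c |` \bigcup_(x in X c) [set a | a <= x /\ r x a <= q].
  move=> a [/=]; rewrite le_eqVlt => /orP[/eqP->|ac rca]; [by left|right].
  by have [n [[Cn an nmin] en rn Fn]] := (rP q ac).1 rca; exists n.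
have [fJ|iJ] := pselect (finite_set J).
  apply: finite_card_lt => //; elim/woset_ind: b => b IH.
  apply: sub_finite_set (sub b) _; rewrite finite_setU; split; first exact: finite_set1.
  apply: bigcup_finite => [|x [Cx _]]; first exact: card_le_finite (XJ b) fJ.
  exact: IH (C_lt Cx).
apply: card_le_lt_trans (e_small q); rewrite -/J; elim/woset_ind: b => b IH.
apply: card_le_trans (subset_card_le (sub b)) _.
have UJ : \bigcup_(x in X b) [set a | a <= x /\ r x a <= q] #<= J.
  by apply: card_le_bigcup => // x [Cx _]; exact: IH (C_lt Cx).
exact: card_le_setU1.
Qed.

Lemma coherent_walk : coherent kappa (fun a b => if a <= b then r b a else r a b).
Proof.
split.
- by move=> a; rewrite lexx r_diag.
- by move=> a b; case: ltgtP => // ->.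
- move=> a b c q ab bc; rewrite ab bc (le_trans ab bc); exact: r_tri.
- by move=> z a zP; rewrite zP r_least.
- move=> a b q la ab; rewrite ab; apply: r_closed => //.
  case: la => a0 aP; split=> // y /aP[x /= rx /andP[yx xa]]; exists x; last by rewrite yx.
  by move: rx; rewrite (ltW (lt_le_trans xa ab)).
- move=> b q; apply: card_le_lt_trans (r_small b q); apply: subset_card_le.
  by move=> a [/= ab]; rewrite ab.
Qed.

End Recursion.

Lemma coherent_ex : exists rho : M -> M -> B, coherent kappa rho.
Proof.
have [r [r_diag rP]] := r_ex.
by exists (fun a b => if a <= b then r b a else r a b); apply: coherent_walk.
Qed.

End Walk.

(** * The lattice of a coherent map *)

Fact tri_display : Order.disp_t. Proof. exact: Order.Disp tt tt. Qed.

(* The proofs are parameters of the type so that its lattice structure can be *)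
(* inferred.                                                                  *)
Definition tri (kappa gamma : wosetType) d (B : bLatticeType d)
    (rho : gamma -> gamma -> B) (rhoP : coherent kappa rho)
    (z : gamma) (zP : forall a, z <= a) : Type := (gamma * B)%type.

Section TriLattice.
Variables (kappa gamma : wosetType) (d : Order.disp_t) (B : bLatticeType d).
Variable rho : gamma -> gamma -> B.
Hypothesis rhoP : coherent kappa rho.
Variable z : gamma.
Hypothesis zP : forall a, z <= a.

Local Notation tri := (tri rhoP zP).
HB.instance Definition _ := Choice.on tri.
Implicit Types u v w : tri.

Fact tri_le_refl : reflexive (tri_le rho : rel tri).
Proof. by move=> u; rewrite /tri_le lexx (rho_diag rhoP) joinx0 lexx. Qed.

Fact tri_le_anti : antisymmetric (tri_le rho : rel tri).
Proof.
move=> [a p] [b q] /andP[/andP[/= ab pq] /andP[/= ba qp]].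
have ab' : a = b by apply/le_anti; rewrite ab.
move: pq qp; rewrite !leUx => /andP[pq _] /andP[qp _].
by rewrite ab'; congr pair; apply/le_anti; rewrite pq.
Qed.

Fact tri_le_trans : transitive (tri_le rho : rel tri).
Proof.
move=> [b q] [a p] [c s]; rewrite /tri_le /= !leUx.
move=> /andP[ab /andP[pq rab]] /andP[bc /andP[qs rbc]].
rewrite (le_trans ab bc) (le_trans pq qs) -(rho_tri rhoP ab bc rbc).
exact: le_trans rab qs.
Qed.

HB.instance Definition _ := @Order.Le_isPOrder.Build tri_display tri
  (tri_le rho) tri_le_refl tri_le_anti tri_le_trans.

Lemma tri_leE u v : (u <= v) = [&& u.1 <= v.1, u.2 <= v.2 & rho u.1 v.1 <= v.2].
Proof. by rewrite [LHS]/(tri_le rho u v) /tri_le leUx. Qed.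

Definition tri_join u v : tri :=
  (Order.max u.1 v.1, (u.2 `|` v.2 `|` rho u.1 v.1)%O).

Fact tri_joinC : commutative tri_join.
Proof.
by move=> u v; rewrite /tri_join maxC (joinC u.2) (rho_sym rhoP u.1).
Qed.

Fact tri_leUx u v w : (tri_join u v <= w) = (u <= w) && (v <= w).
Proof.
wlog uv : u v / u.1 <= v.1.
  move=> H; case/orP: (le_total u.1 v.1) => uv; first exact: H.
  by rewrite tri_joinC andbC H.
rewrite !tri_leE /= !leUx ge_max (max_idPr uv); apply/idP/idP.
  case/and3P => /andP[-> vw] /andP[/andP[-> ->] ruv] rvw.
  by rewrite vw rvw -(rho_tri rhoP uv vw rvw) ruv.
case/andP => /and3P[-> -> ruw] /and3P[vw -> rvw].
by rewrite vw rvw (rho_tri rhoP uv vw rvw) ruw.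
Qed.

HB.instance Definition _ := @Order.POrder_isJoinSemilattice.Build tri_display
  tri tri_join tri_leUx.

Lemma tri_meet_ex u v : exists m : gamma,
  [/\ m <= u.1 /\ m <= v.1, rho m u.1 <= u.2, rho m v.1 <= v.2 &
    forall x, x <= u.1 -> x <= v.1 -> rho x u.1 <= u.2 -> rho x v.1 <= v.2 ->
      x <= m].
Proof.
pose S := [set x | [/\ x <= u.1, x <= v.1, rho x u.1 <= u.2 & rho x v.1 <= v.2]].
have [|m mub mmin] := @woset_min gamma [set m | forall x, S x -> x <= m].
  by exists u.1 => x [].
have mu : m <= u.1 by apply: mmin => x [].
have mv : m <= v.1 by apply: mmin => x [].
suff [ru rv] : rho m u.1 <= u.2 /\ rho m v.1 <= v.2.
  by exists m; split=> // x xu xv ru' rv'; apply: mub.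
have [[]//|nSm] := pselect (S m).
have Sz : S z by split; rewrite ?zP// (rho_least rhoP)// le0x.
have zm : z < m.
  by rewrite lt_neqAle zP andbT; apply/eqP => zm; apply: nSm; rewrite -zm.
have Slim : limit_point S m.
  split=> [|y ym]; first by exists z.
  apply: contrapT => ny; suff : m <= y by rewrite leNgt ym.
  apply: mmin => x Sx; rewrite leNgt; apply/negP => yx; apply: ny; exists x => //.
  rewrite yx lt_neqAle mub// andbT; apply/eqP => xm.
  by apply: nSm; rewrite -xm.
have limS (D : set gamma) : S `<=` D -> limit_point D m.
  by move=> SD; case: Slim => mz mP; split=> // y /mP[x /SD]; exists x.
by split; apply: (rho_closed rhoP) => //; apply: limS => x [].
Qed.

Definition tri_meet u v : tri := (sval (cid (tri_meet_ex u v)), (u.2 `&` v.2)%O).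

Fact tri_lexI u v w : (u <= tri_meet v w) = (u <= v) && (u <= w).
Proof.
rewrite !tri_leE /=; case: cid => m /= [[mv mw] rmv rmw mmax]; rewrite !lexI.
apply/idP/idP.
  case/and3P => um /andP[-> ->] /andP[rv rw].
  by rewrite (le_trans um mv) (le_trans um mw) -(rho_tri rhoP um mv rmv) rv
    -(rho_tri rhoP um mw rmw) rw.
case/andP => /and3P[uv -> rv] /and3P[uw -> rw].
have um : u.1 <= m by apply: mmax.
by rewrite um (rho_tri rhoP um mv rmv) rv (rho_tri rhoP um mw rmw) rw.
Qed.

HB.instance Definition _ := @Order.POrder_isMeetSemilattice.Build tri_display
  tri tri_meet tri_lexI.

Fact tri_le0x u : ((z, \bot) : tri) <= u.
Proof. by rewrite tri_leE /= zP !le0x (rho_least rhoP)// le0x. Qed.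

HB.instance Definition _ := @Order.hasBottom.Build tri_display tri (z, \bot) tri_le0x.

Lemma tri_flat_free k : flat_free k B -> flat_free k.+1 tri.
Proof.
move=> freeB [A [Ajoin [f [fA fI _] fjoin]]]; apply: freeB.
set top := f None.
have joinE u v : (u `|` v)%O = tri_join u v by [].
have f_top i j : i != j -> (f (Some i) `|` f (Some j))%O = top.
  by move=> ij; rewrite -fjoin; congr f; rewrite [LHS]/(flat_join _ _) /flat_join
    (inj_eq Some_inj) (negPf ij).
have f_le x : f x <= top.
  have -> : top = (f x `|` top)%O by rewrite -fjoin; case: x.
  exact: leUl.
have [i0 i0P] : exists i0 : 'I_k.+1, forall i, i != i0 -> (f (Some i)).1 = top.1.
  have [all|/existsNP[i0 ni0]] := pselect (forall i, (f (Some i)).1 = top.1).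
    by exists ord0 => i _.
  exists i0 => i /f_top/(congr1 fst); rewrite joinE /=.
  by case: leP => // _ /ni0.
pose g (x : flat_top 'I_k) : B := (f (omap (lift i0) x)).2.
have f1 (x : flat_top 'I_k) : (f (omap (lift i0) x)).1 = top.1.
  by case: x => [j|//]; apply: i0P; rewrite eq_sym neq_lift.
have g_join x y : g (x `|` y)%O = (g x `|` g y)%O.
  have -> : (g x `|` g y)%O =
      (f (omap (lift i0) x) `|` f (omap (lift i0) y))%O.2.
    by rewrite joinE /= !f1 (rho_diag rhoP) joinx0.
  rewrite -fjoin /g; congr ((f _).2).
  rewrite [(x `|` y)%O]/(flat_join _ _) [RHS]/(flat_join _ _) /flat_join.
  rewrite inj_eq; first by case: ifP.
  by case=> [j|] [j'|] //= /Some_inj/lift_inj->.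
exists (range g); split=> [_ _ [x _ <-] [y _ <-]|].
  by exists (x `|` y)%O.
exists g => //; split=> [x _|x y _ _ gxy|y [x _ <-]]; [by exists x| |by exists x].
have fxy : f (omap (lift i0) x) = f (omap (lift i0) y).
  by apply: injective_projections => //; rewrite !f1.
have := fI _ _ (mem_set I) (mem_set I) fxy.
by case: x y {gxy fxy} => [j|] [j'|] //= /Some_inj/lift_inj->.
Qed.

Lemma tri_ideal_small (kappa_inf : infinite_set [set: kappa]) :
  (forall p : B, card_lt [set q | q <= p] [set: kappa]) ->
  forall u : tri, card_lt [set v | v <= u] [set: kappa].
Proof.
move=> smallB u.
have := card_lt_setX kappa_inf (rho_small rhoP u.1 u.2) (smallB u.2).
apply: card_le_lt_trans; apply: subset_card_le => v /=.
by rewrite tri_leE => /and3P[].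
Qed.

Lemma tri_card : infinite_set [set: gamma] -> [set: B] #<= [set: gamma] ->
  [set: tri] #= [set: gamma].
Proof.
move=> gamma_inf Bgamma; rewrite card_eq_le; apply/andP; split.
  apply: card_le_trans (card_setX_infinite gamma_inf).
  apply: card_le_trans (card_le_setX (card_lexx _) Bgamma).
  by apply: subset_card_le.
by apply: (@fun_card_le _ _ _ _ (fun a => (a, \bot) : tri)) => // x y _ _ [].
Qed.

Definition tri_base (a : gamma) : tri := (a, \bot).

Lemma tri_base_le a u : (tri_base a <= u) = (a <= u.1) && (rho a u.1 <= u.2).
Proof. by rewrite tri_leE /= le0x. Qed.

Lemma tri_base_least a : (forall b, a <= b) -> tri_base a = \bot.
Proof.
by move=> aP; apply/le_anti; rewrite le0x tri_base_le aP (rho_least rhoP)// le0x.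
Qed.

Lemma tri_base_closed a u : limit_point [set b | tri_base b <= u] a -> tri_base a <= u.
Proof.
move=> [ne aP]; have au : a <= u.1.
  rewrite leNgt; apply/negP => /aP[b /=]; rewrite tri_base_le => /andP[bu _].
  by rewrite ltNge bu.
rewrite tri_base_le au (rho_closed rhoP)//; split=> // b /aP[c /=].
by rewrite tri_base_le => /andP[_ rc] bca; exists c.
Qed.

Lemma tri_base_small : (forall u : tri, card_lt [set v | v <= u] [set: kappa]) ->
  forall u : tri, card_lt [set a | tri_base a <= u] [set: kappa].
Proof.
move=> small u; apply: card_le_lt_trans (small u).
by apply: (@fun_card_le _ _ _ _ tri_base) => // x y _ _ [].
Qed.

Lemma tri_special n : infinite_set [set: kappa] -> special_ladder kappa n B ->
  flat_free n.+1 B ->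
  (forall p : B, card_lt [set q | q <= p] [set: kappa]) ->
  special_ladder kappa n.+1 tri.
Proof.
move=> kappa_inf Bspecial Bfree Bsmall; split.
  split; [by exists \bot|exact: tri_flat_free|exact: tri_ideal_small].
exists gamma, d, B, rho; split=> //.
- by move=> a; rewrite (rho_diag rhoP); split=> // b; exact: (rho_sym rhoP).
- by move=> a b; apply: (rho_least rhoP).
- by exists id => //; exists id.
Qed.

End TriLattice.

(** * Iteration *)

Section SquareSequence.
Variable L : wosetType.
Local Notation M := (succ_card L).
Implicit Types (a b x y : M).

Lemma square_sequence (n0 : L) : square L ->
  exists (C : M -> set M) (f : M -> M -> L),
  [/\ forall b x, C b x -> x < b,
      forall b a, a < b -> exists2 x, C b x & a <= x,
      forall b l, l < b -> limit_point (C b) l ->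
        C b l /\ C l = C b `&` segment l,
      forall b x y, C b x -> C b y -> x < y -> f b x < f b y
    & forall b x n, C b x -> n < f b x -> exists2 y, C b y & f b y = n].
Proof.
move=> [C0 C0P].
have [z _ zP] := @woset_min L setT (ex_intro _ n0 I).
have /choice[f0 f0P] : forall b, exists f : M -> L, limit_ordinal b ->
    {in C0 b &, {mono f : x y / x <= y}} /\
    forall x n, C0 b x -> n < f x -> exists2 y, C0 b y & f y = n.
  move=> b; have [lb|nlb] := pselect (limit_ordinal b); last by exists (fun=> n0).
  have [_ [I [Iinit [f [fI _ fsurj] fmono]]] _] := C0P _ lb.
  exists f => _; split=> // x n Cx nx.
  have /fsurj[y Cy fy] : I n by apply: Iinit (fI _ Cx) (ltW nx).
  by exists y.
pose P b := [set x | x < b /\ forall c, ~ x < c < b].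
pose C b := if pselect (limit_ordinal b) then C0 b else P b.
pose f b := if pselect (limit_ordinal b) then f0 b else fun=> z.
exists C, f; split; rewrite /C /f => b.
- move=> x; case: pselect => [lb|_ []//].
  by have [[/(_ x) + _ _] _ _] := C0P _ lb; apply.
- move=> a ab; case: pselect => [lb|nlb].
    by have [[_ + _] _ _] := C0P _ lb; apply.
  have [p pb pP] : exists2 p, p < b & forall c, ~ p < c < b.
    apply: contrapT => np; apply: nlb; split=> [|c cb]; first by exists a.
    by apply: contrapT => nc; apply: np; exists c => // x xP; apply: nc; exists x.
  exists p => //; rewrite leNgt; apply/negP => pa; by case: (pP a); rewrite pa.
- move=> l lb; case: pselect => [limb|nlimb] /= ll.
    have [[_ _ Cclosed] _ Ccoh] := C0P _ limb.
    split; first exact: Cclosed.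
    case: pselect => [?|[]] /=; first exact: Ccoh.
    case: ll => ne lP; split=> // c /lP[x _ cx]; by exists x.
  have [[y yl] lP] := ll; have [x [_ xP] /andP[_ xl]] := lP _ yl.
  by have [c _ /andP[xc cl]] := lP _ xl; case: (xP c); rewrite xc (lt_trans cl lb).
- move=> x y; case: pselect => [lb|nlb] /= Cx Cy xy.
    have [mono _] := f0P _ lb.
    by rewrite !ltNge in xy *; rewrite mono ?inE.
  by have [_ /(_ y)] := Cx; have [yb _] := Cy; rewrite xy yb.
- move=> x n; case: pselect => [lb|nlb] /= Cx nx.
    by have [_ +] := f0P _ lb; apply; [exact: Cx|exact: nx].
  by have := zP n I; rewrite leNgt nx.
Qed.

End SquareSequence.

Lemma card_le_succ (L : wosetType) : [set: L] #<= [set: succ_card L].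
Proof.
case/orP: (card_le_total [set: L] [set: succ_card L]) => // SL.
by have := succ_card_gt L; rewrite SL.
Qed.

Lemma iter_succ_infinite (kappa : wosetType) n : infinite_set [set: kappa] ->
  infinite_set [set: iter n succ_card kappa].
Proof.
move=> kappa_inf; elim: n => // n IH; apply: contra_not IH.
exact/card_le_finite/card_le_succ.
Qed.

HB.instance Definition _ := @Order.hasBottom.Build _ 'I_1 ord0 (fun i => leq0n i).

Definition ladder_data (kappa gamma : wosetType) n : Prop :=
  exists (d : Order.disp_t) (B : bLatticeType d) (rho : gamma -> gamma -> B),
  [/\ coherent kappa rho,
      special_ladder kappa n B, flat_free n.+1 B,
      forall p : B, card_lt [set q | q <= p] [set: kappa]
    & [set: B] #<= [set: gamma]].

Lemma ladder_data0 (kappa : wosetType) : is_cardinal kappa ->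
  infinite_set [set: kappa] -> ladder_data kappa kappa 0.
Proof.
move=> kappaP kappa_inf.
pose B : bLatticeType _ := Order.BLattice.clone _ 'I_1 _.
have all0 (p q : B) : p = q by rewrite (ord1 p) (ord1 q).
exists _, B, (fun _ _ => \bot); split.
- split=> // b q.
  apply: card_le_lt_trans (card_lt_setU1 b kappa_inf (kappaP b)).
  by apply: subset_card_le => a [/=]; rewrite le_eqVlt => /orP[/eqP|]; [left|right].
- by exists \bot.
- move=> [A [_ [f [_ fI _] _]]].
  by have := fI (Some ord0) None (mem_set I) (mem_set I) (all0 _ _).
- by move=> p; apply: finite_card_lt kappa_inf; exact: (@finite_finset 'I_1).
- have [k _] := infinite_setN0 kappa_inf.
  by apply: (@fun_card_le _ _ _ _ (fun=> k)).
Qed.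

Lemma ladder_dataS (kappa L : wosetType) n : infinite_set [set: kappa] ->
  infinite_set [set: L] -> square L ->
  ladder_data kappa L n -> ladder_data kappa (succ_card L) n.+1.
Proof.
move=> kappa_inf L_inf sqL [d [B [rho [rhoP Bspecial Bfree Bsmall Bcard]]]].
have [n0 _] := infinite_setN0 L_inf.
have [z _ zP] := @woset_min L setT (ex_intro _ n0 I).
have {}zP a : z <= a by apply: zP.
have [C [f [C_lt C_cof C_lim f_mono f_init]]] := square_sequence n0 sqL.
have smallT := tri_ideal_small (rhoP := rhoP) (zP := zP) kappa_inf Bsmall.
have [rho' rho'P] := coherent_ex C_lt C_cof
  (fun b l lb ll => (C_lim b l lb ll).1) (fun b l lb ll => (C_lim b l lb ll).2)
  f_mono f_init kappa_inf (tri_base_least rhoP zP) (@tri_base_closed _ _ _ _ _ rhoP _ zP)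
  (tri_base_small smallT).
exists tri_display, (tri rhoP zP), rho'; split=> //.
- exact: tri_special.
- exact: tri_flat_free.
- apply: card_le_trans (card_le_succ L).
  by have := tri_card rhoP zP L_inf Bcard; rewrite card_eq_le => /andP[].
Qed.

Theorem theorem7p1 (kappa : wosetType) (n : nat) :
  is_cardinal kappa -> infinite_set [set: kappa]%classic ->
  (forall m, (m < n)%N -> square (iter m succ_card kappa)) ->
  exists (d : Order.disp_t) (S : latticeType d),
    special_ladder kappa n.+1 S /\
    ([set: S]%classic #= [set: iter n succ_card kappa]%classic)%card.
Proof.
move=> kappaP kappa_inf sq.
have [d [B [rho [rhoP Bspecial Bfree Bsmall Bcard]]]] :
    ladder_data kappa (iter n succ_card kappa) n.
  elim: n sq => [_|n IH sq]; first exact: ladder_data0.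
  apply: ladder_dataS => //; [exact: iter_succ_infinite|exact: sq|].
  by apply: IH => m mn; apply: sq; apply: leqW.
have inf := iter_succ_infinite (n := n) kappa_inf.
have [n0 _] := infinite_setN0 inf.
have [z _ zP] := @woset_min _ setT (ex_intro _ n0 I).
have {}zP a : z <= a by apply: zP.
exists tri_display, (tri rhoP zP); split; first exact: tri_special.
exact: tri_card.
Qed.
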